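(* Let $0\le\lambda<\gamma\le\delta$ and let $\mathfrak{f}=\mathfrak{s}+\overline{\mathfrak{t}}\in\mathcal{R}_H^0(\gamma,\delta,\lambda)$ with $\mathfrak{t}(z)=\sum_{m\ge2}b_mz^m$. Then for every $m\ge2$, $$|b_m|\le\frac{2(\gamma-\lambda)}{m^2[2\gamma+(\delta-\gamma)(m-1)]}.$$ The result is sharp: equality holds for the function $\mathfrak{f}(z)=z+\frac{2(\gamma-\lambda)}{m^2[2\gamma+(\delta-\gamma)(m-1)]}\bar z^m$.
   Context: Let $\mathcal{U}=\{z\in\mathbb{C}:|z|<1\}$. $\mathcal{H}^0$ denotes the class of complex-valued harmonic functions $\mathfrak{f}=\mathfrak{s}+\overline{\mathfrak{t}}$ on $\mathcal{U}$, where $\mathfrak{s}(z)=z+\sum_{m\ge2}a_mz^m$ and $\mathfrak{t}(z)=\sum_{m\ge2}b_mz^m$ are analytic in $\mathcal{U}$. For real $0\le\lambda<\gamma\le\delta$, $\mathcal{R}_H^0(\gamma,\delta,\lambda)$ is the class of $\mathfrak{f}=\mathfrak{s}+\overline{\mathfrak{t}}\in\mathcal{H}^0$ such that for all $z\in\mathcal{U}$, $\mathrm{Re}\left[\gamma\mathfrak{s}'(z)+\delta z\mathfrak{s}''(z)+\frac{\delta-\gamma}{2}z^2\mathfrak{s}'''(z)-\lambda\right]>\left|\gamma\mathfrak{t}'(z)+\delta z\mathfrak{t}''(z)+\frac{\delta-\gamma}{2}z^2\mathfrak{t}'''(z)\right|$. *)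

(* Defs.v *)
From HB Require Import structures.
From mathcomp Require Import all_boot all_order all_algebra.
From mathcomp Require Import all_classical all_reals all_analysis.
From mathcomp Require Import complex.
Set Implicit Arguments. Unset Strict Implicit. Unset Printing Implicit Defensive.
Import Order.TTheory GRing.Theory Num.Theory ComplexField.
Import numFieldTopology.Exports numFieldNormedType.Exports.
Local Open Scope ring_scope.
Local Open Scope classical_set_scope.

(* Complex numbers over a real type R : C = R[i], equipped with the
   standard (norm-induced) topology and normed-module structure over itself,
   exactly as MathComp-Analysis does for any numFieldType. *)
Local Set Warnings "-redundant-canonical-projection -HB.no-new-instance".
HB.instance Definition _ (R : rcfType) :=
  PseudoPointedMetric.copy R[i] (R[i])^o.
HB.instance Definition _ (R : rcfType) :=
  GRing.ComAlgebra.copy R[i] (R[i])^o.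
HB.instance Definition _ (R : rcfType) := Vector.copy R[i] (R[i])^o.
HB.instance Definition _ (R : rcfType) := NormedModule.copy R[i] (R[i])^o.


Definition unit_disc (R : realType) : set R[i] := [set z | `|z| < 1].

Definition power_series_on_disc (R : realType) (c : nat -> R[i])
    (f : R[i] -> R[i]) : Prop :=
  forall z, unit_disc z ->
    series (fun k => c k * z ^+ k) @ \oo --> f z.

(** Class H^0: f = s + conj t with s(z) = z + sum_{m>=2} a_m z^m,
    t(z) = sum_{m>=2} b_m z^m, analytic in U; we record s, t and the
    coefficient sequences. *)
Definition in_H0 (R : realType) (s t : R[i] -> R[i]) : Prop :=
  exists a b : nat -> R[i],
    [/\ a 0%N = 0 /\ a 1%N = 1, b 0%N = 0 /\ b 1%N = 0,
        power_series_on_disc a s & power_series_on_disc b t].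

Definition Lop (R : realType) (gamma delta : R) (h : R[i] -> R[i]) (z : R[i])
  : R[i] :=
  (gamma%:C)%C * derive1 h z + (delta%:C)%C * z * derive1n 2 h z
  + (((delta - gamma) / 2)%:C)%C * z ^+ 2 * derive1n 3 h z.

Definition in_RH0 (R : realType) (gamma delta lambda : R)
    (s t : R[i] -> R[i]) : Prop :=
  in_H0 s t /\
  forall z, unit_disc z ->
    `|Lop gamma delta t z| < 'Re (Lop gamma delta s z - (lambda%:C)%C).

(* Main.v *)
Require Import Defs.
From HB Require Import structures.
From mathcomp Require Import all_boot all_order all_algebra.
From mathcomp Require Import all_classical all_reals all_analysis.
From mathcomp Require Import complex.
From mathcomp Require Import cyclic separable cyclotomic.
From mathcomp Require Import ring lra zify.
Set Implicit Arguments. Unset Strict Implicit. Unset Printing Implicit Defensive.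
Import Order.TTheory GRing.Theory Num.Theory ComplexField.
Import numFieldTopology.Exports numFieldNormedType.Exports.
Local Open Scope ring_scope.

(* The operator [Lop] multiplies the coefficient of z^m by
   K_m = m^2 (2 gamma + (delta - gamma) (m - 1)) / 2 and shifts it to z^(m - 1).
   So S := Lop s - lambda and T := Lop t are power series with |T| < Re S on
   the disc, S(0) = gamma - lambda, and T has coefficients K_m b_m.  Averaging
   T(z) z^-k over |z| = r gives |T_k| r^k <= mean |T| <= mean Re S = Re S(0);
   let r tend to 1.  The average is taken over the n-th roots of unity rather
   than by integration: it is exact for polynomials of degree < n, and the
   partial sums of T and S converge uniformly on |z| <= r. *)

(** * Absolute summability inside the disc and geometric tail bounds *)

Definition abs_summable_on_disc (K : numFieldType) (c : nat -> K) : Prop :=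
  forall r : K, 0 <= r -> r < 1 ->
    exists B : K, forall n, \sum_(k < n) `|c k| * r ^+ k <= B.

Definition deriv_coef (K : numFieldType) (c : nat -> K) (k : nat) : K :=
  k.+1%:R * c k.+1.

Lemma ex_between (K : numFieldType) (x y : K) : x < y -> exists z, x < z /\ z < y.
Proof. by move=> /midf_lt[xz zy]; exists ((x + y) / 2). Qed.

Lemma geometric_sum_le (K : numFieldType) (q : K) (n : nat) :
  0 <= q -> q < 1 -> \sum_(k < n) q ^+ k <= (1 - q)^-1.
Proof.
move=> q0 q1; have d0 : 0 < 1 - q by rewrite subr_gt0.
rewrite -[leRHS]mul1r ler_pdivlMr // mulrC -opprB mulNr -subrX1 opprB.
by rewrite gerBl exprn_ge0.
Qed.

Lemma norm_lim_le (K : numFieldType) (u : nat -> K) (l B : K) :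
  (forall n, `|u n| <= B) -> (u n @[n --> \oo] --> l)%classic -> `|l| <= B.
Proof.
move=> uB /cvgrPdist_le ul; apply/ler_addgt0Pr => e /ul [N _ /(_ N)] /=.
move=> /(_ (leqnn N)) le; rewrite addrC -[l](subrK (u N)).
by rewrite (le_trans (ler_normD _ _))// lerD.
Qed.

(* (s - r) times the derivative of x^(k+1) at r is at most s^(k+1) - r^(k+1): this is
   what makes the termwise derivative summable on a smaller disc. *)
Lemma mulrn_expr_le (K : numFieldType) (r s : K) (k : nat) :
  0 <= r -> r <= s -> k.+1%:R * r ^+ k * (s - r) <= s ^+ k.+1.
Proof.
move=> r0 rs; apply: (@le_trans _ _ (s ^+ k.+1 - r ^+ k.+1)); last first.
  by rewrite gerBl exprn_ge0.
rewrite subrXX mulrC ler_wpM2l ?subr_ge0 //.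
have -> : k.+1%:R * r ^+ k = \sum_(i < k.+1) r ^+ k.
  by rewrite sumr_const card_ord mulr_natl.
apply: ler_sum => i _ /=; have ik : (i <= k)%N by rewrite -ltnS.
rewrite -{1}(subnK ik) exprD ler_wpM2r ?exprn_ge0 //.
by rewrite lerXn2r ?nnegrE // (le_trans r0).
Qed.

Lemma abs_summable_deriv (K : numFieldType) (c : nat -> K) :
  abs_summable_on_disc c -> abs_summable_on_disc (deriv_coef c).
Proof.
move=> cs r r0 r1; have [s [rs s1]] := ex_between r1.
have s0 : 0 <= s by exact: le_trans r0 (ltW rs).
have [B cB] := cs s s0 s1; exists (B / (s - r)) => n.
have d0 : 0 < s - r by rewrite subr_gt0.
rewrite ler_pdivlMr // mulr_suml; apply: le_trans (cB n.+1).
rewrite big_ord_recl -[leLHS]add0r lerD ?mulr_ge0 ?exprn_ge0 //.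
apply: ler_sum => k _; rewrite lift0 /deriv_coef normrM normr_nat.
rewrite [_ * `|_|]mulrC -!mulrA ler_wpM2l // mulrA.
by rewrite mulrn_expr_le // ltW.
Qed.

Lemma norm_partial_sum_le (K : numFieldType) (c : nat -> K) (z r : K) (m n : nat) :
  `|z| <= r ->
  `|\sum_(m <= k < n) c k * z ^+ k| <= \sum_(m <= k < n) `|c k| * r ^+ k.
Proof.
move=> zr; apply: le_trans (ler_norm_sum _ _ _) _; apply: ler_sum => k _.
rewrite normrM normrX ler_wpM2l // lerXn2r ?nnegrE //.
exact: le_trans zr.
Qed.

(** For k >= m, r^k = s^k (r/s)^k <= s^k (r/s)^m. The resulting bound depends on neither z nor n,
    which is the source of uniform convergence on |z| <= r. *)
Lemma partial_sum_tail_le (K : numFieldType) (c : nat -> K) (z r s B : K) (m n : nat) :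
  `|z| <= r -> r <= s -> 0 < s ->
  (forall n, \sum_(k < n) `|c k| * s ^+ k <= B) -> (m <= n)%N ->
  `|\sum_(m <= k < n) c k * z ^+ k| <= B * (r / s) ^+ m.
Proof.
move=> zr rs s0 cB mn; have r0 : 0 <= r by exact: le_trans zr.
apply: le_trans (norm_partial_sum_le _ _ _ zr) _.
apply: (@le_trans _ _ (\sum_(m <= k < n) (`|c k| * s ^+ k) * (r / s) ^+ m)).
  rewrite !big_nat; apply: ler_sum => k /andP[mk _].
  rewrite -mulrA ler_wpM2l // -(subnK mk) !exprD -mulrA -exprMn.
  rewrite [s * _]mulrC divfK ?gt_eqF // ler_wpM2r ?exprn_ge0 //.
  by rewrite lerXn2r ?nnegrE // ltW.
rewrite -mulr_suml ler_wpM2r ?exprn_ge0 ?divr_ge0 ?(ltW s0) //.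
apply: le_trans (cB n); rewrite -(big_mkord xpredT (fun k => `|c k| * s ^+ k)).
rewrite (big_cat_nat (n := m) (m := 0%N)) //= -[leLHS]add0r lerD //.
by apply: sumr_ge0 => k _; rewrite mulr_ge0 ?exprn_ge0 ?(ltW s0).
Qed.

(** Abel's argument: at a radius s strictly between r and 1 the terms tend to 0, hence are bounded
    by some M, and the series at r is dominated by M times the geometric series of ratio r/s. *)
Lemma abs_summable_of_cvg (K : numFieldType) (c : nat -> K) :
  (forall z : K, `|z| < 1 -> cvgn (series (fun k => c k * z ^+ k))) ->
  abs_summable_on_disc c.
Proof.
move=> cc r r0 r1; have [s [rs s1]] := ex_between r1.
have s0 : 0 < s by exact: le_lt_trans r0 rs.
have [M cM] : exists M, forall k, `|c k * s ^+ k| <= M.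
  have /cvg_series_cvg_0 h : cvgn (series (fun k => c k * s ^+ k)).
    by apply: cc; rewrite gtr0_norm.
  have /cvg_seq_bounded [M [_ MP]] : cvgn (fun k => c k * s ^+ k).
    by apply/cvg_ex; exists 0.
  have [M1 ?] : exists M1, M < M1.
    by exists (M + 1); rewrite ltrDl.
  exists M1 => k; exact: (MP M1).
have q1 : r / s < 1 by rewrite ltr_pdivrMr // mul1r.
have q0 : 0 <= r / s by rewrite divr_ge0 // ltW.
exists (M * (1 - r / s)^-1) => n.
have M0 : 0 <= M by exact: le_trans (cM 0%N).
apply: le_trans (ler_wpM2l M0 (geometric_sum_le n q0 q1)).
rewrite mulr_sumr; apply: ler_sum => k _.
have -> : `|c k| * r ^+ k = `|c k * s ^+ k| * (r / s) ^+ k.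
  rewrite normrM normrX (gtr0_norm s0) expr_div_n -mulrA (mulrCA _ (r ^+ k)) mulfV ?mulr1 //.
  by rewrite expf_neq0 // gt_eqF.
by rewrite ler_wpM2r // exprn_ge0.
Qed.

(** * Convergence of complex series through real and imaginary parts *)

Lemma norm_real_complex (R : rcfType) (x : R) : `|x%:C%C| = `|x|%:C%C.
Proof. by rewrite normc_def /= expr0n addr0 sqrtr_sqr. Qed.

Lemma normc_le_Re_Im (R : rcfType) (z : R[i]) :
  `|z| <= (`|complex.Re z| + `|complex.Im z|)%:C%C.
Proof.
rewrite {1}(complexE z) (le_trans (ler_normD _ _)) // normrM rmorphD /=.
by rewrite !norm_real_complex normc_def /= expr0n expr1n add0r sqrtr1 mul1r.
Qed.

Lemma normc_ge_Im (R : rcfType) (z : R[i]) : `|complex.Im z|%:C%C <= `|z|.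
Proof.
have := normc_ge_Re (z * 'i%C); rewrite ReiNIm normrN normrM.
by rewrite [X in _ * X]normc_def /= expr0n expr1n add0r sqrtr1 mulr1.
Qed.

(** In the order of R[i] only numbers with zero imaginary part are comparable with 0, so every
    complex epsilon is a real one; this reduces limits in R[i] to limits in R. *)
Lemma gt0_complex_real (R : rcfType) (e : R[i]) : 0 < e -> exists2 d : R, 0 < d & e = d%:C%C.
Proof.
by case: e => u v; rewrite ltcE /= => /andP[/eqP -> u0]; exists u.
Qed.

Lemma cvg_complex (R : realType) (u : nat -> R[i]) (a b : R) :
  (complex.Re (u n) @[n --> \oo] --> a)%classic ->
  (complex.Im (u n) @[n --> \oo] --> b)%classic ->
  (u n @[n --> \oo] --> (a +i* b)%C)%classic.
Proof.
move=> /cvgrPdist_le ua /cvgrPdist_le ub; apply/cvgrPdist_le => _ /gt0_complex_real[d d0 ->].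
have d20 : 0 < d / 2 by rewrite divr_gt0.
have [N _ HN] := filterI (ua _ d20) (ub _ d20); exists N => // n /HN [/= ha hb].
apply: le_trans (normc_le_Re_Im _) _; rewrite lecR [leRHS]splitr.
by case: (u n) ha hb => x y /= ha hb; rewrite lerD.
Qed.

Lemma real_abs_bounded_cvg (R : realType) (v : nat -> R) (B : R) :
  (forall n, \sum_(k < n) `|v k| <= B) -> cvgn (series v).
Proof.
move=> vB; apply: normed_cvg; apply: nondecreasing_is_cvgn.
  by apply: nondecreasing_series => k _ _; exact: normr_ge0.
exists B => _ [n _ <-]; apply: le_trans (vB n).
by rewrite -(big_mkord xpredT (fun k => `|v k|)).
Qed.

(* R[i] has no completeness instance, so convergence is obtained from the real and
   imaginary parts. *)
Lemma complex_abs_bounded_cvg (R : realType) (u : nat -> R[i]) (B : R[i]) :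
  (forall n, \sum_(k < n) `|u k| <= B) -> cvgn (series u).
Proof.
move=> uB; have B0 : 0 <= B by have := uB 0%N; rewrite big_ord0.
have bound (v : nat -> R) : (forall k, `|v k|%:C%C <= `|u k|) -> cvgn (series v).
  move=> vu; apply: (@real_abs_bounded_cvg _ _ (complex.Re B)) => n.
  rewrite -lecR RRe_real ?ger0_real //.
  apply: le_trans (uB n); rewrite rmorph_sum /=; exact: ler_sum.
have /cvg_ex [a ca] := bound _ (fun k => normc_ge_Re (u k)).
have /cvg_ex [b cb] := bound _ (fun k => normc_ge_Im (u k)).
apply/cvg_ex; exists (a +i* b)%C; apply: cvg_complex.
  rewrite (_ : (fun n => _) = series (fun k => complex.Re (u k))) //.
  apply/funext => n; rewrite /series /=.
  by apply: (big_morph (@complex.Re R)) => // -[? ?] [? ?].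
rewrite (_ : (fun n => _) = series (fun k => complex.Im (u k))) //.
apply/funext => n; rewrite /series /=.
by apply: (big_morph (@complex.Im R)) => // -[? ?] [? ?].
Qed.

Lemma complex_geometric_eventually_le (R : realType) (M q e : R[i]) :
  0 <= M -> 0 <= q -> q < 1 -> 0 < e ->
  exists N, forall n, (N <= n)%N -> M * q ^+ n <= e.
Proof.
move=> M0 q0 q1 /gt0_complex_real[d d0 ->].
(* [M + 1] rather than [M], so that the divisor [x] below is positive. *)
have [x x0 Mx] : exists2 x : R, 0 < x & M + 1 = x%:C%C.
  by apply: gt0_complex_real; rewrite ltr_wpDl.
have Eq : q = (complex.Re q)%:C%C by rewrite RRe_real // ger0_real.
move: q0 q1; rewrite {}Eq; move: (complex.Re q) => {}q q0 q1.
rewrite -(rmorph1 (real_complex R)) ltcR in q1.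
rewrite -(rmorph0 (real_complex R)) lecR in q0.
have q1' : `|q| < 1 by rewrite ger0_norm.
have /cvgrPdist_le /(_ (d / x)) := cvg_expr q1'.
rewrite divr_gt0 // => /(_ isT)[N _ HN]; exists N => n /HN /=.
rewrite sub0r normrN ger0_norm ?exprn_ge0 // ler_pdivlMr // => qd.
apply: (@le_trans _ _ (x%:C%C * q%:C%C ^+ n)).
  by rewrite ler_wpM2r ?exprn_ge0 ?lecR // -Mx lerDl.
by rewrite -rmorphXn -rmorphM lecR mulrC.
Qed.

Lemma abs_summable_cvg (R : realType) (c : nat -> R[i]) (z : R[i]) :
  abs_summable_on_disc c -> `|z| < 1 -> cvgn (series (fun k => c k * z ^+ k)).
Proof.
move=> cs /(cs _ (normr_ge0 z))[B cB].
apply: (@complex_abs_bounded_cvg _ _ B) => n; apply: le_trans (cB n).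
by apply: ler_sum => k _; rewrite normrM normrX.
Qed.

Lemma power_series_abs_summable (R : realType) (c : nat -> R[i]) (f : R[i] -> R[i]) :
  power_series_on_disc c f -> abs_summable_on_disc c.
Proof. by move=> cf; apply: abs_summable_of_cvg => z /cf zf; apply/cvg_ex; exists (f z). Qed.

(** * Second-order Taylor estimate and termwise differentiation *)

Lemma taylor2_monomial_le (K : numFieldType) (z w r : K) (k : nat) :
  `|z| <= r -> `|w| <= r ->
  `|w ^+ k.+2 - z ^+ k.+2 - (w - z) * (k.+2%:R * z ^+ k.+1)| <=
    `|w - z| ^+ 2 * (k.+2%:R * k.+1%:R * r ^+ k).
Proof.
move=> zr wr; have r0 : 0 <= r by exact: le_trans zr.
elim: k => [|k IH].
  have -> : w ^+ 2 - z ^+ 2 - (w - z) * (2 * z ^+ 1) = (w - z) ^+ 2 by ring.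
  by rewrite normrX ler_peMr ?exprn_ge0 // expr0 !mulr1 ler1n.
(* The remainder Q_k obeys Q_(k+1) = w Q_k + (w - z)^2 (k+2) z^(k+1). The constants then add up to
   (k+2)(k+1) + (k+2) = (k+2)^2 <= (k+3)(k+2). *)
have -> : w ^+ k.+3 - z ^+ k.+3 - (w - z) * (k.+3%:R * z ^+ k.+2) =
    w * (w ^+ k.+2 - z ^+ k.+2 - (w - z) * (k.+2%:R * z ^+ k.+1)) +
    (w - z) ^+ 2 * (k.+2%:R * z ^+ k.+1).
  by rewrite (_ : k.+3%:R = k.+2%:R + 1) ?[in RHS]natr1 // !exprS; ring.
apply: le_trans (ler_normD _ _) _; rewrite !normrM !normrX normr_nat.
apply: (@le_trans _ _ (r * (`|w - z| ^+ 2 * (k.+2%:R * k.+1%:R * r ^+ k)) +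
                       `|w - z| ^+ 2 * (k.+2%:R * r ^+ k.+1))).
  rewrite lerD //; first by rewrite ler_pM.
  by rewrite !ler_wpM2l ?exprn_ge0 // lerXn2r ?nnegrE.
have -> : r * (`|w - z| ^+ 2 * (k.+2%:R * k.+1%:R * r ^+ k)) +
    `|w - z| ^+ 2 * (k.+2%:R * r ^+ k.+1) =
    `|w - z| ^+ 2 * (k.+2%:R * k.+2%:R * r ^+ k.+1).
  have -> : k.+2%:R = k.+1%:R + 1 :> K by rewrite natr1.
  by rewrite (exprS r); ring.
rewrite ler_wpM2l ?exprn_ge0 // ler_wpM2r ?exprn_ge0 //.
by rewrite ler_wpM2r // ler_nat.
Qed.

Lemma cvg_sub_sub_mul (K : numFieldType) (u v t : nat -> K) (x a b c : K) :
  (u n @[n --> \oo] --> a)%classic -> (v n @[n --> \oo] --> b)%classic ->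
  (t n @[n --> \oo] --> c)%classic ->
  (u n - v n - x * t n @[n --> \oo] --> a - b - x * c)%classic.
Proof.
move=> ua vb tc; apply: cvgB; first exact: cvgB.
by apply: cvgM => //; exact: cvg_cst.
Qed.

(** [B] bounds the second termwise derivative at radius r, so summing the monomial estimates and
    passing to the limit leaves a remainder quadratic in w - z. *)
Lemma power_series_taylor2 (K : numFieldType) (c : nat -> K) (z w r B fz fw L : K) :
  `|z| <= r -> `|w| <= r ->
  (forall n, \sum_(k < n) `|deriv_coef (deriv_coef c) k| * r ^+ k <= B) ->
  (series (fun k => c k * z ^+ k) @ \oo --> fz)%classic ->
  (series (fun k => c k * w ^+ k) @ \oo --> fw)%classic ->
  (series (fun k => deriv_coef c k * z ^+ k) @ \oo --> L)%classic ->
  `|fw - fz - (w - z) * L| <= `|w - z| ^+ 2 * B.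
Proof.
move=> zr wr cB.
(* Terms of degree 0 and 1 have no remainder: sums of [c] up to n + 2 and of [deriv_coef c] up to n
   + 1 combine into exactly n monomial remainders. *)
rewrite -(cvg_shiftn 2) => cz; rewrite -(cvg_shiftn 2) => cw; rewrite -cvg_shiftS => cL.
have cl := @cvg_sub_sub_mul _ _ _ _ (w - z) _ _ _ cw cz cL.
apply: norm_lim_le cl => n /=.
rewrite /series /= addn2.
have -> : \sum_(0 <= k < n.+2) c k * w ^+ k - \sum_(0 <= k < n.+2) c k * z ^+ k
    - (w - z) * \sum_(0 <= k < n.+1) deriv_coef c k * z ^+ k =
    \sum_(k < n) c k.+2 *
      (w ^+ k.+2 - z ^+ k.+2 - (w - z) * (k.+2%:R * z ^+ k.+1)).
  rewrite !big_mkord; elim: n => [|n IH].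
    by rewrite !big_ord_recr !big_ord0 /= /deriv_coef; ring.
  rewrite big_ord_recr [X in _ - X - _]big_ord_recr [X in _ - _ * X]big_ord_recr.
  by rewrite [RHS]big_ord_recr /= -IH /deriv_coef; ring.
apply: le_trans (ler_norm_sum _ _ _) _.
apply: (@le_trans _ _ (`|w - z| ^+ 2 * \sum_(k < n) `|deriv_coef (deriv_coef c) k| * r ^+ k)); last first.
  by rewrite ler_wpM2l ?exprn_ge0.
rewrite mulr_sumr; apply: ler_sum => k _; rewrite normrM.
apply: le_trans (ler_wpM2l (normr_ge0 _) (taylor2_monomial_le _ zr wr)) _.
rewrite /deriv_coef !normrM !normr_nat.
rewrite le_eqVlt; apply/orP; left; apply/eqP; ring.
Qed.

(** Dividing by h leaves an error of at most |h| M in the difference quotient. *)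
Lemma derive1_of_quadratic (K : numFieldType) (f : K -> K) (z L M d : K) :
  0 < d -> 
  (forall h, `|h| < d -> `|f (h + z) - f z - h * L| <= `|h| ^+ 2 * M) ->
  derive1 f z = L.
Proof.
move=> d0 fM; apply: cvg_lim; first exact: norm_hausdorff.
(* Testing the hypothesis at h = d / 2 forces M to be nonnegative. *)
have M0 : 0 <= M.
  have h0 : 0 < `|d / 2| by rewrite normr_gt0 gt_eqF // divr_gt0.
  rewrite -(pmulr_rge0 _ (exprn_gt0 2 h0)) (le_trans _ (fM (d / 2) _)) //.
  by rewrite gtr0_norm ?divr_gt0 // gtr_pMr // invf_lt1 // ltr1n.
apply/cvgrPdist_le => e e0.
have d'0 : 0 < e / (M + 1) by rewrite divr_gt0 // ltr_wpDl.
near=> h.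
have h0 : h != 0 by near: h; exact: nbhs_dnbhs_neq.
have hd : `|h| < d by near: h; exact: dnbhs0_lt.
have he : `|h| < e / (M + 1) by near: h; exact: dnbhs0_lt.
have -> : L - h^-1 *: (f (h + z) - f z) = - (h^-1 * (f (h + z) - f z - h * L)).
  by rewrite /GRing.scale /= [in RHS]mulrBr mulKf // opprB.
rewrite normrN normrM normfV mulrC ler_pdivrMr ?normr_gt0 //.
apply: le_trans (fM _ hd) _; rewrite expr2 -mulrA mulrC ler_wpM2r //.
rewrite mulrC; apply: (@le_trans _ _ ((M + 1) * `|h|)).
  by rewrite ler_wpM2r // lerDl.
by rewrite mulrC -ler_pdivlMr ?ltW // ltr_wpDl.
Unshelve. all: end_near.
Qed.

Lemma power_series_derive1 (R : realType) (c : nat -> R[i]) (f : R[i] -> R[i]) :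
  power_series_on_disc c f -> power_series_on_disc (deriv_coef c) (derive1 f).
Proof.
move=> cf z z1; have cs := power_series_abs_summable cf.
have /cvg_ex[L cL] := abs_summable_cvg (abs_summable_deriv cs) z1.
have [r [zr r1]] := ex_between z1.
have [B cB] := abs_summable_deriv (abs_summable_deriv cs) (le_trans (normr_ge0 z) (ltW zr)) r1.
suff -> : derive1 f z = L by [].
(* For |h| < r - |z| the point h + z stays within radius r < 1, where [B] applies. *)
apply: (@derive1_of_quadratic _ _ _ _ B (r - `|z|)); first by rewrite subr_gt0.
move=> h; rewrite ltrBrDr => /ltW hr.
have hzr : `|h + z| <= r by exact: le_trans (ler_normD _ _) hr.
have hz1 : unit_disc (h + z) by exact: le_lt_trans hzr r1.
have := power_series_taylor2 (ltW zr) hzr cB (cf _ z1) (cf _ hz1) cL.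
by rewrite (addrK z h).
Qed.

(** * Averages over roots of unity *)

Lemma closed_field_prim_root (C : numClosedFieldType) (n : nat) :
  (0 < n)%N -> exists z : C, n.-primitive_root z.
Proof.
move=> n0; pose p : {poly C} := 'X^n - 1.
have [r Dp] := closed_field_poly_normal p.
rewrite (monicP _) ?monicXnsubC // scale1r in Dp.
(* The n roots of X^n - 1 are distinct by separability in characteristic 0, and n distinct n-th
   roots of unity in a field include a primitive one. *)
have rn1 : all n.-unity_root r by apply/allP => z; rewrite -root_prod_XsubC -Dp.
have sz_r : (n < (size r).+1)%N by rewrite -(size_prod_XsubC r id) -Dp size_XnsubC.
have [|z] := hasP (has_prim_root n0 rn1 _ sz_r); last by exists z.
by rewrite -separable_prod_XsubC -Dp separable_Xn_sub_1 // pnatr_eq0 -lt0n.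
Qed.

(** If n does not divide t, the sum is geometric of ratio w^t != 1; multiplied by w^t - 1 it
    telescopes to w^(tn) - 1 = 0. *)
Lemma prim_root_sum_exp (K : fieldType) (n : nat) (w : K) (t : nat) :
  n.-primitive_root w ->
  \sum_(i < n) (w ^+ i) ^+ t = if (n %| t)%N then n%:R else 0.
Proof.
move=> wn; rewrite (prim_order_dvd wn); case: eqP => [wt1|/eqP wt1].
  rewrite (eq_bigr (fun=> 1)) ?sumr_const ?card_ord // => i _.
  by rewrite exprAC wt1 expr1n.
apply/eqP; move: wt1; rewrite -subr_eq0 => /mulfI wt1; apply/eqP/wt1.
rewrite mulr0 (eq_bigr (fun i : 'I_n => (w ^+ t) ^+ i)); last by move=> i _; rewrite exprAC.
by rewrite -subrX1 exprAC (prim_expr_order wn) expr1n subrr.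
Qed.

(** A discrete Cauchy formula: the exponent n - m stands for -m, since (w^i)^n = 1. *)
Lemma prim_root_coef_sum (K : fieldType) (n m : nat) (w r : K) (c : nat -> K) :
  n.-primitive_root w -> (m < n)%N ->
  \sum_(i < n) (\sum_(k < n) c k * (r * w ^+ i) ^+ k) * (w ^+ i) ^+ (n - m) =
  n%:R * (c m * r ^+ m).
Proof.
move=> wn mn; under eq_bigr do rewrite mulr_suml.
rewrite exchange_big /= (bigD1 (Ordinal mn)) //= [X in _ + X]big1 ?addr0; last first.
  move=> k km.
  rewrite (eq_bigr (fun i : 'I_n => c k * r ^+ k * (w ^+ i) ^+ (k + (n - m)))); last first.
    by move=> i _; rewrite exprMn exprD !mulrA.
  rewrite -mulr_sumr prim_root_sum_exp //; case: ifP => [/dvdnP[q Eq]|_]; last by rewrite mulr0.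
  (* k + (n - m) lies strictly between 0 and 2n, so if n divides it, it equals n and k = m. *)
  case/negP: km; apply/eqP/val_inj => /=.
  by have := ltn_ord k; case: q Eq => [|[|q]]; nia.
rewrite (eq_bigr (fun i : 'I_n => c m * r ^+ m * (w ^+ i) ^+ n)); last first.
  by move=> i _; rewrite exprMn !mulrA -mulrA -exprD subnKC // ltnW.
by rewrite -mulr_sumr prim_root_sum_exp // dvdnn mulrC.
Qed.

(** The constant [A] leaves room for the truncation errors made when partial sums replace full
    series. *)
Lemma polynomial_coef_le_Re (C : numClosedFieldType) (n m : nat) (e u : nat -> C) (r A : C) :
  (m < n)%N -> 0 <= r ->
  (forall z, `|z| = r ->
     `|\sum_(k < n) e k * z ^+ k| <= 'Re (\sum_(k < n) u k * z ^+ k) + A) ->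
  `|e m| * r ^+ m <= 'Re (u 0%N) + A.
Proof.
move=> mn r0 H; have n0 : (0 < n)%N by exact: leq_ltn_trans mn.
have [w wn] := closed_field_prim_root C n0.
have w1 i : `|w ^+ i| = 1.
  apply/eqP; rewrite -(@pexpr_eq1 _ _ n) // -normrX exprAC.
  by rewrite (prim_expr_order wn) expr1n normr1.
have n0' : 0 < n%:R :> C by rewrite ltr0n.
rewrite -(ler_pM2l n0') -{1}(ger0_norm r0) -normrX -normrM -{1}normr_nat -normrM.
rewrite -(prim_root_coef_sum _ _ wn mn) (le_trans (ler_norm_sum _ _ _)) //.
apply: (@le_trans _ _ (\sum_(i < n) ('Re (\sum_(k < n) u k * (r * w ^+ i) ^+ k) + A))).
  apply: ler_sum => i _; rewrite normrM normrX w1 expr1n mulr1.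
  by apply: H; rewrite normrM w1 mulr1 ger0_norm.
rewrite big_split /= sumr_const card_ord -raddf_sum /= mulrDr -[A *+ n]mulr_natl lerD2r.
(* The coefficient formula at m = 0: its weights are (w^i)^n = 1, so the plain mean of the values is
   u_0. *)
have := prim_root_coef_sum r u wn n0; rewrite expr0 mulr1 subn0.
rewrite (eq_bigr (fun i : 'I_n => \sum_(k < n) u k * (r * w ^+ i) ^+ k)) => [->|i _].
  by rewrite !mulr_natl raddfMn.
by rewrite exprAC (prim_expr_order wn) expr1n mulr1.
Qed.

(** * Passage from partial sums to power series *)

Lemma power_series_unif_approx (R : realType) (c : nat -> R[i]) (f : R[i] -> R[i])
    (r e : R[i]) :
  power_series_on_disc c f -> 0 <= r -> r < 1 -> 0 < e ->
  exists N, forall n z, (N <= n)%N -> `|z| <= r ->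
    `|f z - \sum_(k < n) c k * z ^+ k| <= e.
Proof.
move=> cf r0 r1 e0; have [s [rs s1]] := ex_between r1.
have s0 : 0 < s by exact: le_lt_trans rs.
have [B cB] := power_series_abs_summable cf (ltW s0) s1.
have B0 : 0 <= B by have := cB 0%N; rewrite big_ord0.
have q1 : r / s < 1 by rewrite ltr_pdivrMr // mul1r.
have q0 : 0 <= r / s by rewrite divr_ge0 // ltW.
(* N comes from the tail bound B (r/s)^n alone, hence is chosen before z. *)
have [N HN] := complex_geometric_eventually_le B0 q0 q1 e0.
exists N => n z Nn zr; apply: le_trans (HN _ Nn).
have fz : (series (fun k => c k * z ^+ k) x @[x --> \oo] --> f z)%classic.
  by apply: cf; exact: le_lt_trans zr r1.
(* After a shift by n, [f z] minus the n-th partial sum is a limit of tails that start at n. *)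
rewrite -(cvg_shiftn n) in fz.
have cl : ((series (fun k => c k * z ^+ k) (x + n)%N - \sum_(k < n) c k * z ^+ k) @[x --> \oo] -->
    f z - \sum_(k < n) c k * z ^+ k)%classic.
  by apply: cvgB; [exact: fz | exact: cvg_cst].
apply: norm_lim_le cl => j; rewrite /series /=.
rewrite (big_cat_nat (n := n)) ?leq_addl //= big_mkord addrAC subrr add0r.
by apply: (partial_sum_tail_le zr (ltW rs) s0 cB); rewrite leq_addl.
Qed.

(** Letting r tend to 1 is done by the explicit choice r = 1 - h, together with Bernoulli's 1 - (1 -
    h)^m <= h m. *)
Lemma le_of_mul_expr_le (K : numFieldType) (x A : K) (m : nat) :
  0 <= x -> (forall r, 0 <= r -> r < 1 -> x * r ^+ m <= A) -> x <= A.
Proof.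
move=> x0 H; apply/ler_addgt0Pr => e e0.
have D0 : 0 < e + m%:R * x + 1 by rewrite addr_gt0 // ltr_pwDl // mulr_ge0.
(* The summand m x of the denominator gives x h m <= e; the other two ensure 0 < h < 1. *)
pose h := e / (e + m%:R * x + 1).
have h0 : 0 < h by rewrite divr_gt0.
have h1 : h < 1 by rewrite ltr_pdivrMr // mul1r -addrA ltrDl ltr_wpDl // mulr_ge0.
have r0 : 0 <= 1 - h by rewrite subr_ge0 ltW.
have r1 : 1 - h < 1 by rewrite gtrBl.
have := H _ r0 r1; rewrite -(lerD2r e); apply: le_trans.
rewrite -lerBlDl -{1}[x]mulr1 -mulrBr.
have -> : 1 - (1 - h) ^+ m = h * \sum_(i < m) (1 - h) ^+ i.
  by rewrite -opprB subrX1 addrAC subrr add0r mulNr opprK.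
apply: (@le_trans _ _ (x * (h * m%:R))).
  rewrite !ler_wpM2l ?(ltW h0) // -[m in leRHS]card_ord -sumr_const.
  by apply: ler_sum => i _; rewrite exprn_ile1 // ltW.
rewrite mulrCA /h mulrAC ler_pdivrMr // ler_wpM2l ?(ltW e0) //.
by rewrite mulrC -addrA addrCA lerDl addr_ge0 ?(ltW e0).
Qed.

(** On |z| = r the partial sums of T and S inherit the inequality up to d/2 each, so the polynomial
    bound applies with slack d; both d > 0 and r < 1 are arbitrary. *)
Lemma power_series_coef_le_Re (R : realType) (e u : nat -> R[i]) (T S : R[i] -> R[i])
    (m : nat) :
  power_series_on_disc e T -> power_series_on_disc u S ->
  (forall z, unit_disc z -> `|T z| <= 'Re (S z)) ->
  `|e m| <= 'Re (u 0%N).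
Proof.
move=> eT uS TS; apply: (@le_of_mul_expr_le _ _ _ m) => // r r0 r1.
apply/ler_addgt0Pr => d d0; have d20 : 0 < d / 2 by rewrite divr_gt0.
have [N1 H1] := power_series_unif_approx eT r0 r1 d20.
have [N2 H2] := power_series_unif_approx uS r0 r1 d20.
(* One length serves both approximations and includes the term of degree m. *)
pose n := maxn m.+1 (maxn N1 N2).
apply: (@polynomial_coef_le_Re _ n) => //; first by rewrite leq_maxl.
move=> z zr.
have h1 : `|T z - \sum_(k < n) e k * z ^+ k| <= d / 2.
  by apply: H1; rewrite ?zr // leq_max leq_maxl orbT.
have h2 : `|S z - \sum_(k < n) u k * z ^+ k| <= d / 2.
  by apply: H2; rewrite ?zr // leq_max leq_maxr !orbT.
have z1 : unit_disc z by rewrite /unit_disc /= zr.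
rewrite -[X in `|X|](subKr (T z)) (le_trans (ler_normB _ _)) //.
rewrite [d]splitr addrA lerD // (le_trans (TS z z1)) //.
rewrite -lerBlDl -raddfB /= (le_trans _ h2) //.
by have [] := leif_Re_Creal (S z - \sum_(k < n) u k * z ^+ k).
Qed.

(** * Operations on power series and the action of [Lop] on coefficients *)

Lemma power_series_add (R : realType) (c d : nat -> R[i]) (f g : R[i] -> R[i]) :
  power_series_on_disc c f -> power_series_on_disc d g ->
  power_series_on_disc (fun k => c k + d k) (fun z => f z + g z).
Proof.
move=> cf dg z z1.
rewrite (_ : series _ = fun n => series (fun k => c k * z ^+ k) n +
                                 series (fun k => d k * z ^+ k) n).
  by apply: cvgD; [exact: cf | exact: dg].
apply/funext => n; rewrite /series /= -big_split /=.
by apply: eq_bigr => k _; rewrite mulrDl.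
Qed.

Lemma power_series_scale (R : realType) (a : R[i]) (c : nat -> R[i]) (f : R[i] -> R[i]) :
  power_series_on_disc c f -> power_series_on_disc (fun k => a * c k) (fun z => a * f z).
Proof.
move=> cf z z1.
rewrite (_ : series _ = fun n => a * series (fun k => c k * z ^+ k) n).
  by apply: cvgM; [exact: cvg_cst | exact: cf].
apply/funext => n; rewrite /series /= mulr_sumr.
by apply: eq_bigr => k _; rewrite mulrA.
Qed.

Arguments power_series_scale {R} a {c f} _ [z] _.

Definition shift_coef (K : numFieldType) (c : nat -> K) (k : nat) : K :=
  if k is j.+1 then c j else 0.

Lemma power_series_shift (R : realType) (c : nat -> R[i]) (f : R[i] -> R[i]) :
  power_series_on_disc c f -> power_series_on_disc (shift_coef c) (fun z => z * f z).
Proof.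
move=> cf z z1; rewrite -cvg_shiftS.
have E : (fun n => z * series (fun k => c k * z ^+ k) n) =
         (fun n => series (fun k => shift_coef c k * z ^+ k) n.+1).
  apply/funext => n; rewrite /series /= !big_mkord big_ord_recl /= mul0r add0r mulr_sumr.
  by apply: eq_bigr => k _; rewrite exprS mulrCA.
have cv : ((fun n => z * series (fun k => c k * z ^+ k) n) x @[x --> \oo] --> z * f z)%classic.
  by apply: cvgM; [exact: cvg_cst | exact: cf].
by rewrite E in cv; exact: cv.
Qed.

Lemma power_series_monomial (R : realType) (a : R[i]) (m : nat) :
  power_series_on_disc (fun k => if k == m then a else 0) (fun z => a * z ^+ m).
Proof.
move=> z _; apply/cvgrPdist_le => e e0; exists m.+1 => // n /= mn.
rewrite /series /= big_mkord (bigD1 (Ordinal mn)) //= eqxx big1; last first.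
  by move=> k /negbTE km; rewrite -val_eqE /= in km; rewrite km mul0r.
by rewrite addr0 subrr normr0 ltW.
Qed.

Arguments power_series_monomial {R} a m [z] _.

(** Serves to evaluate [Lop] on the extremal functions by comparing coefficients instead of
    differentiating. *)
Lemma power_series_unique (R : realType) (c : nat -> R[i]) (f g : R[i] -> R[i]) (z : R[i]) :
  power_series_on_disc c f -> power_series_on_disc c g -> unit_disc z -> f z = g z.
Proof.
move=> cf cg z1; have h := cf z z1; have h' := cg z z1.
by apply: (cvg_unique _ h h'); exact: norm_hausdorff.
Qed.

(** Differentiating z^m termwise gives the factor m (gamma + delta (m - 1) + (delta - gamma) (m - 1)
    (m - 2) / 2); this is its factored form, half the denominator of the bound. *)
Definition Lop_coef (R : realType) (gamma delta : R) (m : nat) : R :=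
  m%:R ^+ 2 * (2 * gamma + (delta - gamma) * (m%:R - 1)) / 2.

Lemma Lop_power_series (R : realType) (gamma delta : R) (c : nat -> R[i]) (h : R[i] -> R[i]) :
  power_series_on_disc c h ->
  power_series_on_disc (fun k => (Lop_coef gamma delta k.+1)%:C%C * c k.+1)
    (Lop gamma delta h).
Proof.
move=> ch; have h1 := power_series_derive1 ch.
have h2 := power_series_derive1 h1; have h3 := power_series_derive1 h2.
have := power_series_add (power_series_add (power_series_scale gamma%:C%C h1)
  (power_series_scale delta%:C%C (power_series_shift h2)))
  (power_series_scale ((delta - gamma) / 2)%:C%C (power_series_shift (power_series_shift h3))).
rewrite (_ : (fun k => _ + _) = fun k => (Lop_coef gamma delta k.+1)%:C%C * c k.+1).
  rewrite (_ : (fun z => _ + _) = Lop gamma delta h) //.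
  by apply/funext => z; rewrite /Lop /= expr2 !mulrA.
apply/funext => k; rewrite /Lop_coef /deriv_coef /shift_coef.
rewrite !(rmorphM, rmorphD, rmorphN, rmorphXn, rmorph_nat, fmorphV, rmorph1) /=.
(* For k = 0 and k = 1 the zeros inserted by [shift_coef] agree with the vanishing factors k and k
   (k - 1), so one closed form covers every k. *)
by case: k => [|[|k]] /=; field.
Qed.

Arguments Lop_power_series {R} gamma delta {c h} _ [z] _.

Lemma Lop_coef_gt0 (R : realType) (gamma delta : R) (m : nat) :
  0 < gamma -> gamma <= delta -> (0 < m)%N -> 0 < Lop_coef gamma delta m.
Proof.
move=> g0 gd m0; rewrite divr_gt0 // mulr_gt0 ?exprn_gt0 ?ltr0n //.
by rewrite ltr_pwDl ?mulr_gt0 // mulr_ge0 ?subr_ge0 // ler1n.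
Qed.

(** * The coefficient bound and its extremal functions *)

Theorem theorem6 (R : realType) (gamma delta lambda : R) :
  0 <= lambda -> lambda < gamma -> gamma <= delta ->
  (* coefficient bound *)
  (forall (s t : R[i] -> R[i]) (b : nat -> R[i]),
     in_RH0 gamma delta lambda s t ->
     b 0%N = 0 -> b 1%N = 0 -> power_series_on_disc b t ->
     forall m : nat, (2 <= m)%N ->
       `|b m| <= ((2 * (gamma - lambda)) /
                  ((m%:R) ^+ 2 * (2 * gamma + (delta - gamma) * (m%:R - 1))))%:C%C)
  /\
  (* sharpness: f(z) = z + c conj(z)^m, i.e. s(z) = z, t(z) = c z^m *)
  (forall m : nat, (2 <= m)%N ->
     let c : R := (2 * (gamma - lambda)) /
                  ((m%:R) ^+ 2 * (2 * gamma + (delta - gamma) * (m%:R - 1))) in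
     in_RH0 gamma delta lambda (fun z => z) (fun z => c%:C%C * z ^+ m)).
Proof.
move=> l0 lg gd; have g0 : 0 < gamma by exact: le_lt_trans lg.
have boundE (m : nat) : 2 * (gamma - lambda) /
    (m%:R ^+ 2 * (2 * gamma + (delta - gamma) * (m%:R - 1))) =
    (gamma - lambda) / Lop_coef gamma delta m.
  by rewrite /Lop_coef invf_div mulrCA mulrA.
split=> [s t b [[a [_ [[_ a1] _ sa _]]] Lst] _ _ tb m m2|m m2 c].
  have K0 : 0 < Lop_coef gamma delta m by rewrite Lop_coef_gt0 // (ltn_trans _ m2).
  (* From here [m] is the predecessor of the original index: [Lop] moves b_(m+1) to degree m. *)
  rewrite boundE; case: m m2 K0 => // m m2 K0.
  (* -lambda enters as a monomial of degree 0. Since K_1 = gamma and a_1 = 1, the constant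
     coefficient of the sum is gamma - lambda. *)
  have Ss := power_series_add (Lop_power_series gamma delta sa)
               (power_series_monomial (- lambda%:C%C) 0).
  have := power_series_coef_le_Re m (Lop_power_series gamma delta tb) Ss.
  rewrite /= a1 mulr1 normrM norm_real_complex (gtr0_norm K0) => H.
  rewrite rmorphM /= fmorphV /= ler_pdivlMr ?ltcR // mulrC (le_trans (H _)) //.
    by move=> z /Lst /ltW; rewrite expr0 mulr1.
  by rewrite -rmorphN -rmorphD -complexRe /= lecR /Lop_coef; lra.
split.
  exists (fun k => if k == 1%N then 1 else 0), (fun k => if k == m then c%:C%C else 0).
  split=> //=.
  - by split; case: m m2 c => [|[]].
  - by move=> z z1; have := power_series_monomial 1 1 z1; rewrite mul1r expr1.
  - exact: power_series_monomial.
move=> z z1.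
have Id : power_series_on_disc (fun k => if k == 1%N then 1 else 0) (fun z : R[i] => z).
  by move=> y y1; have := power_series_monomial 1 1 y1; rewrite mul1r expr1.
(* Only K_1 = gamma survives; the factor z^0 keeps the shape of [power_series_monomial]. *)
have -> : Lop gamma delta (fun z => z) z = gamma%:C%C * z ^+ 0.
  apply: (power_series_unique (Lop_power_series gamma delta Id) _ z1).
  have := power_series_monomial gamma%:C%C 0.
  rewrite (_ : (fun k => _) = fun k => (Lop_coef gamma delta k.+1)%:C%C * (if k.+1 == 1%N then 1 else 0)) //.
  apply/funext => -[|k] /=; last by rewrite mulr0.
  by rewrite mulr1 /Lop_coef; congr (_%:C)%C; lra.
(* By [boundE], c = (gamma - lambda) / K_m, so K_m c reduces to gamma - lambda. *)
have -> : Lop gamma delta (fun z => c%:C%C * z ^+ m) z = (gamma - lambda)%:C%C * z ^+ m.-1.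
  have Lt := Lop_power_series gamma delta (power_series_monomial c%:C%C m).
  apply: (@power_series_unique _ _ _ (fun z => (gamma - lambda)%:C%C * z ^+ m.-1) z Lt _ z1).
  have := power_series_monomial (gamma - lambda)%:C%C m.-1.
  rewrite (_ : (fun k => _) = fun k => (Lop_coef gamma delta k.+1)%:C%C * (if k.+1 == m then c%:C%C else 0)) //.
  apply/funext => k /=; rewrite -(eqSS k) prednK; last by rewrite (ltn_trans _ m2).
  case: eqP => [->|_]; last by rewrite mulr0.
  by rewrite -rmorphM /c boundE mulrC divfK // gt_eqF // Lop_coef_gt0 // (ltn_trans _ m2).
(* What remains is (gamma - lambda) |z|^(m-1) < gamma - lambda, strict because |z| < 1 and m - 1 >
   0. *)
rewrite expr0 mulr1 -rmorphB -complexRe [complex.Re _]/= normrM normrX.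
rewrite norm_real_complex (@gtr0_norm _ (gamma - lambda)) ?subr_gt0 //.
rewrite gtr_pMr ?ltcR ?subr_gt0 //.
by rewrite exprn_ilt1 // -lt0n -ltnS prednK // (ltn_trans _ m2).
Qed.
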